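(* Let $\lambda>0$, $\mathcal K>0$, $\sigma>0$ be constants and $h_n=\mathcal K^{2/3}(n\lambda)^{-2/3}$. Consider the regression-type model: one observes $Y_i=X_{i/n}+\varepsilon_i$, $i=0,\dots,n$, where $\varepsilon_i\ge0$ are i.i.d., independent of $X$, with distribution function $F_\lambda$ satisfying $F_\lambda(x)=\lambda x(1+o(1))$ as $x\downarrow0$. Suppose that for a fixed bin number $k$ one has $X_t=X_{kh_n}+\int_{kh_n}^t\sigma\,dW_s$ for $t\in[kh_n,(k+1)h_n)$. Let $$m_{n,k}=\min\{Y_i:\ i=kh_nn,\,kh_nn+1,\dots,(k+1)h_nn-1\},\qquad \mathcal R_{n,k}=m_{n,k}-X_{kh_n}.$$ Then for all $x\in\mathbb R$ $$\lim_{n\to\infty}\mathbb P\Big(h_n^{-1/2}\mathcal R_{n,k}>x\sigma\Big)=\mathbb E\Big[\exp\Big(-\mathcal K\sigma\int_0^1(x+W_t)_+\,dt\Big)\Big].$$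
   Context: $W$ is a standard Brownian motion (for a filtration to which $X$ is adapted), and $A_+=\max(A,0)$. For simplicity it is assumed that $h_n^{-1}\in\mathbb N$ and $nh_n\in\mathbb N$ (the limit is along such $n$). *)

(* Defs.v *)
From HB Require Import structures.
From mathcomp Require Import all_boot all_order all_algebra.
From mathcomp Require Import all_classical all_reals all_analysis.
Set Implicit Arguments.
Unset Strict Implicit.
Unset Printing Implicit Defensive.
Import Order.TTheory GRing.Theory Num.Theory.
Import numFieldNormedType.Exports.
Local Open Scope classical_set_scope.
Local Open Scope ring_scope.

Section processes.
Context {d : measure_display} {T : measurableType d} {R : realType}.
Variable P : probability T R.

(* The sigma-algebra generated by the variables X i, i in D. *)
Definition sigma_gen (I : Type) (D : set I) (X : I -> T -> R) : set (set T) :=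
  <<s \bigcup_(i in D) preimage_set_system setT (X i) measurable >>.

Definition independent_systems (G H : set (set T)) : Prop :=
  forall A B, G A -> H B -> P (A `&` B) = (P A * P B)%E.

Definition mutually_independent (I : choiceType) (X : I -> T -> R) : Prop :=
  forall (J : seq I) (B : I -> set R), uniq J ->
    (forall i, measurable (B i)) ->
    P (\bigcap_(i in [set` J]) (X i @^-1` B i)) =
    (\prod_(i <- J) P (X i @^-1` B i))%E.

(* Time is real-valued; only nonnegative times are constrained. *)
Definition filtration (F : R -> set (set T)) : Prop :=
  [/\ forall t, 0 <= t -> sigma_algebra setT (F t),
      forall t, 0 <= t -> F t `<=` measurable &
      forall s t, 0 <= s -> s <= t -> F s `<=` F t].

Definition adapted (D : set R) (F : R -> set (set T)) (X : R -> T -> R) : Prop :=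
  forall t, D t -> preimage_set_system setT (X t) measurable `<=` F t.

(* The second parameter of normal_prob is the standard deviation. *)
Definition standard_brownian_motion (F : R -> set (set T)) (W : R -> T -> R)
    : Prop :=
  [/\ adapted `[0, +oo[ F W,
      {ae P, forall w, W 0 w = 0},
      {ae P, forall w, {within `[0, +oo[, continuous (fun t => W t w)}},
      forall s t, 0 <= s -> s < t -> forall B : set R, measurable B ->
        P ((W t \- W s) @^-1` B) = normal_prob 0 (Num.sqrt (t - s)) B &
      forall s t, 0 <= s -> s < t ->
        independent_systems (F s)
          (preimage_set_system setT (W t \- W s) measurable)].

(* The stochastic integral of the constant sigma against W over [a, t]: a
   constant is an elementary integrand, for which the Ito integral is by
   definition the integrand times the increment of the integrator. *)
Definition stoch_int_cst (sigma : R) (W : R -> T -> R) (a t : R) : T -> R :=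
  fun w => sigma * (W t w - W a w).

End processes.

Section model.
Context {R : realType}.

Definition bin_width (K lambda : R) (n : nat) : R :=
  K `^ (2 / 3) * (n%:R * lambda) `^ (- (2 / 3)).

Definition admissible (K lambda : R) : set nat :=
  [set n | [/\ (0 < n)%N, (bin_width K lambda n)^-1 \is a Num.nat &
               n%:R * bin_width K lambda n \is a Num.nat]].

(* The number n h_n of observations per bin; truncn is exact when n is
   admissible. *)
Definition bin_size (K lambda : R) (n : nat) : nat :=
  Num.truncn (n%:R * bin_width K lambda n).

Definition observation (T : Type) (X : R -> T -> R) (eps : nat -> T -> R)
    (n i : nat) : T -> R :=
  fun w => X (i%:R / n%:R) w + eps i w.

(* The default value Y_(k n h_n) of the iterated minimum is itself one of the
   observations in the (nonempty) bin. *)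
Definition bin_min (T : Type) (K lambda : R) (X : R -> T -> R)
    (eps : nat -> T -> R) (n k : nat) : T -> R :=
  fun w => let b := bin_size K lambda n in
    \big[Order.min/observation X eps n (k * b)%N w]_((k * b)%N <= i < (k.+1 * b)%N)
      observation X eps n i w.

Definition bin_residual (T : Type) (K lambda : R) (X : R -> T -> R)
    (eps : nat -> T -> R) (n k : nat) : T -> R :=
  fun w => bin_min K lambda X eps n k w - X (k%:R * bin_width K lambda n) w.

End model.

(* Main.v *)
(** Given X, the event says that each of the b = n h observations of the bin has
    noise exceeding x sigma sqrt(h) - (X_t - X_kh), so by independence its
    probability is the expectation of a product of survival functions along the
    Gaussian random walk of the increments of W in the bin.  Such an expectation
    depends only on the law of the steps; by reflection and scaling the walk can
    be replaced by x + W_(j/b), j < b, for the fixed path W.  Since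
    lambda sqrt(h) b = K, the product then converges for every continuous path, as
    a Riemann sum in the exponent, and dominated convergence concludes. *)

Require Import Defs.
From HB Require Import structures.
From mathcomp Require Import all_boot all_order all_algebra.
From mathcomp Require Import all_classical all_reals all_analysis.
From mathcomp Require Import measurable_realfun.
From mathcomp Require Import ring lra.
Import Order.TTheory GRing.Theory Num.Theory.
Import numFieldNormedType.Exports.
Local Open Scope classical_set_scope.
Local Open Scope ring_scope.
Set Implicit Arguments.
Unset Strict Implicit.
Unset Printing Implicit Defensive.

(** Rescaled to unit time, the path of W inside the bin need not converge as n grows, whereas a
    pointwise limit needs walks read off one path. The exchange is an equality of expectations, not
    of paths, and rests only on what the filtration offers: each step is Gaussian and independent of
    the past. Integrating out the steps from the last to the first leaves a number, [walk_value],
    that depends on the step law alone; computing it for both walks gives the equality without any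
    joint law of a vector. Two more obstacles shape the limit. There are b = K / (lambda sqrt(h))
    factors, while the noise law is known only up to o(y) at 0, so the error of a factor must be
    small relative to the positive part of its threshold: the errors then add up to a small multiple
    of a Riemann sum. And paths are continuous only off a null set, on which the limit functional
    may fail to be measurable, so limits are taken on its complement. *)

(** * Independence and sub-sigma-algebras *)

Section independence.
Local Open Scope ereal_scope.
Context d d1 d2 (T : measurableType d) (T1 : measurableType d1)
  (T2 : measurableType d2) (R : realType).
Variable P : probability T R.

(** Independence on rectangles makes the law of the pair a product measure, and Tonelli splits the
    integral. The targets are arbitrary so that [phi] may be the identity from T to T with a smaller
    sigma-algebra: independence from a sigma-algebra then becomes independence of two variables. *)
Lemma ge0_integral_indep (phi : T -> T1) (psi : T -> T2)
    (f : T1 * T2 -> \bar R) :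
  measurable_fun setT phi -> measurable_fun setT psi ->
  (forall A B, measurable A -> measurable B ->
    P (phi @^-1` A `&` psi @^-1` B) = P (phi @^-1` A) * P (psi @^-1` B)) ->
  measurable_fun setT f -> (forall z, 0 <= f z) ->
  \int[P]_w f (phi w, psi w) = \int[P]_w \int[P]_w' f (phi w, psi w').
Proof.
move=> mphi mpsi indep mf f0.
have mpair : measurable_fun setT (fun w => (phi w, psi w)).
  exact: measurable_fun_pair.
pose Phi : {RV P >-> T1} := mfun_Sub (mem_set mphi).
pose Psi : {RV P >-> T2} := mfun_Sub (mem_set mpsi).
pose Pair : {RV P >-> (T1 * T2)%type} := mfun_Sub (mem_set mpair).
transitivity (\int[distribution P Pair]_z f z).
  by rewrite ge0_integral_distribution.
transitivity (\int[distribution P Phi \x distribution P Psi]_z f z).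
  apply: eq_measure_integral => /= A mA _; apply/esym.
  apply: product_measure_unique => // B C mB mC; exact: indep.
have mF := measurable_fun_fubini_tonelli_F (m2 := distribution P Psi) f mf f0.
rewrite fubini_tonelli1// ge0_integral_distribution//; last first.
  by move=> y; apply: integral_ge0.
apply: eq_integral => w _ /=; rewrite /fubini_F ge0_integral_distribution//.
exact: measurableT_comp.
Qed.
End independence.

Section sub_sigma_algebra.
Context d (T : measurableType d).

Lemma measurable_fun_sub_sigma_algebra d' (T' : measurableType d')
    (G : set (set T)) (f : T -> T') :
  preimage_set_system setT f measurable `<=` G ->
  measurable_fun setT (f : g_sigma_algebraType G -> T').
Proof.
by move=> fG _ B mB; apply: sub_gen_smallest; apply: fG; exists B.
Qed.

Lemma measurable_id_sub_sigma_algebra (G : set (set T)) :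
  G `<=` measurable ->
  measurable_fun setT (id : T -> g_sigma_algebraType G).
Proof.
move=> Gm _ B mB; rewrite setTI preimage_id.
move: mB; apply: smallest_sub => //; exact: sigma_algebra_measurable.
Qed.

End sub_sigma_algebra.

(** * Noises exceeding thresholds, deterministic and then random *)

Lemma mutually_independent_gt d (T : measurableType d) (R : realType)
    (P : probability T R) (eps : nat -> {RV P >-> R}) (G : R -> R)
    (i0 b : nat) (u : nat -> R) :
  mutually_independent P (fun i => eps i : T -> R) ->
  (forall i x, cdf (eps i) x = (G x)%:E) ->
  P [set w | forall j, (j < b)%N -> u j < eps (i0 + j)%N w] =
  (\prod_(j < b) (1 - G (u j)))%:E.
Proof.
move=> indep cdfE.
have -> : [set w | forall j, (j < b)%N -> u j < eps (i0 + j)%N w] =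
    \bigcap_(i in [set` [seq (i0 + j)%N | j <- iota 0 b]])
      (eps i @^-1` `]u (i - i0)%N, +oo[).
  apply/seteqP; split=> w /= uE => [i /= /mapP[j]|j jb].
    rewrite mem_iota add0n => /andP[_ jb] ->.
    by rewrite addKn in_itv/= andbT uE.
  have := uE (i0 + j)%N; rewrite addKn/= in_itv/= andbT; apply.
  by apply: map_f; rewrite mem_iota.
rewrite indep; last 2 first.
- by rewrite map_inj_uniq ?iota_uniq// => i j /addnI.
- by move=> i; exact: measurable_itv.
rewrite big_map -{1}(subn0 b) -/(index_iota 0 b) big_mkord.
rewrite -prodEFin; apply: eq_bigr => j _.
rewrite addKn.
have -> : eps (i0 + j)%N @^-1` `]u j, +oo[ = ~` (eps (i0 + j)%N @^-1` `]-oo, u j]).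
  by apply/seteqP; split=> w /=; rewrite !in_itv/= andbT ltNge; move/negP.
rewrite probability_setC; last by rewrite -[X in measurable X]setTI; exact: measurable_funP.
by rewrite EFinB -(cdfE (i0 + j)%N).
Qed.

(** Conditioning on [H]: the thresholds are frozen at a sample point, the deterministic case gives
    the probability over the noises, and the result is averaged over the thresholds. *)
Lemma prob_gt_indep d (T : measurableType d) (R : realType)
    (P : probability T R) (eps : nat -> {RV P >-> R}) (G : R -> R)
    (H : set (set T)) (i0 b : nat) (U : nat -> T -> R) :
  mutually_independent P (fun i => eps i : T -> R) ->
  (forall i x, cdf (eps i) x = (G x)%:E) ->
  sigma_algebra setT H -> H `<=` measurable ->
  independent_systems P (sigma_gen setT (fun i => eps i : T -> R)) H ->
  (forall j, (j < b)%N -> preimage_set_system setT (U j) measurable `<=` H) ->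
  P [set w | forall j, (j < b)%N -> U j w < eps (i0 + j)%N w] =
  (\int[P]_w (\prod_(j < b) (1 - G (U j w)))%:E)%E.
Proof.
move=> indep cdfE sH mH indepH UH.
pose E := \bigcup_(i in [set: nat]) preimage_set_system setT (eps i) measurable.
pose TH := g_sigma_algebraType H.
pose TE := g_sigma_algebraType E.
have EE i : preimage_set_system setT (eps i) measurable `<=` E.
  by move=> A ?; exists i.
have Em : <<s E >> `<=` measurable.
  apply: smallest_sub; first exact: sigma_algebra_measurable.
  by move=> _ [i _ [B mB <-]]; exact: measurable_funP.
have mU j : (j < b)%N -> measurable_fun setT (U j : TH -> R).
  by move=> jb; apply: measurable_fun_sub_sigma_algebra; exact: UH.
have meps i : measurable_fun setT (eps i : TE -> R).
  by apply: measurable_fun_sub_sigma_algebra; exact: EE.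
(* The two roles of the sample point are separated: the first coordinate carries the thresholds, the
   second the noises. The event is the trace of [S] on the diagonal. *)
pose S : set (TH * TE) := \bigcap_(j in `I_b)
  ((fun z : TH * TE => eps (i0 + j)%N (z.2 : T) - U j (z.1 : T)) @^-1` `]0, +oo[).
have SE w w' : S (w, w') = (forall j, (j < b)%N -> U j w < eps (i0 + j)%N w').
  by apply: eq_forall => j; rewrite /= in_itv/= andbT subr_gt0.
have mS : measurable S.
  apply: bigcap_measurableType => j jb; rewrite -[X in measurable X]setTI.
  have : measurable_fun setT
      (fun z : TH * TE => eps (i0 + j)%N (z.2 : T) - U j (z.1 : T)).
    apply: measurable_funB.
      exact: (measurableT_comp (meps _) measurable_snd).
    exact: (measurableT_comp (mU _ jb) measurable_fst).
  by apply=> //; exact: measurable_itv.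
have mSE w : measurable [set w' | forall j, (j < b)%N -> U j w < eps (i0 + j)%N w'].
  have -> : [set w' | forall j, (j < b)%N -> U j w < eps (i0 + j)%N w'] =
      \bigcap_(j in `I_b) (eps (i0 + j)%N @^-1` `]U j w, +oo[).
    apply/funext => w'; apply: eq_forall => j; apply: eq_forall => _.
    by rewrite /= in_itv/= andbT.
  apply: bigcap_measurableType => j _; rewrite -[X in measurable X]setTI.
  exact: measurable_funP.
have mfH := measurable_id_sub_sigma_algebra mH.
have mfE : measurable_fun setT (id : T -> TE).
  by move=> _ B mB; rewrite setTI preimage_id; exact: Em.
have mD : measurable [set w | forall j, (j < b)%N -> U j w < eps (i0 + j)%N w].
  have -> : [set w | forall j, (j < b)%N -> U j w < eps (i0 + j)%N w] =
     (fun w => (w : TH, w : TE)) @^-1` S by apply/seteqP; split=> w; rewrite /preimage/= SE.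
  by rewrite -[X in measurable X]setTI; exact: (measurable_fun_pair mfH mfE).
have PE A : measurable A -> P A = (\int[P]_w (\1_A w)%:E)%E.
  by move=> mA; rewrite integral_indic// setIT.
rewrite PE//.
transitivity (\int[P]_w (\1_S (w : TH, w : TE))%:E)%E.
  by apply: eq_integral => w _; rewrite !indicE; congr ((_ : bool)%:R)%:E;
    apply/idP/idP; rewrite !inE SE.
rewrite (@ge0_integral_indep _ _ _ _ TH TE _ P id id (fun z => (\1_S z)%:E))//.
- apply: eq_integral => w _; rewrite -(mutually_independent_gt i0 b (U^~ w) indep cdfE).
  rewrite PE//; apply: eq_integral => w' _; by rewrite !indicE; congr ((_ : bool)%:R)%:E;
    apply/idP/idP; rewrite !inE SE.
- move=> A B mA mB; rewrite !preimage_id setIC muleC; apply: indepH.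
    exact: mB.
  by rewrite -(sigma_algebra_id sH).
- exact/measurable_EFinP/measurable_indic.
Qed.

(** * Expectations of products along a random walk *)

Section walk.
Local Open Scope ereal_scope.
Context (R : realType).

(* walk_value mu g m y is the expectation of g(y) g(y+Z_1) ... g(y+Z_1+...+Z_(m-1))
   for i.i.d. steps Z_i of law mu. *)
Fixpoint walk_value (mu : set R -> \bar R) (g : R -> \bar R) (m : nat) (y : R)
    : \bar R :=
  if m is m'.+1 then g y * \int[mu]_z walk_value mu g m' (y + z)%R else 1.

Variables (mu : probability R R) (g : R -> \bar R).
Hypotheses (mg : measurable_fun setT g) (g0 : forall y, 0 <= g y).

Lemma walk_value_ge0 m y : 0 <= walk_value mu g m y.
Proof.
elim: m y => [|m IH] y //=.
by rewrite mule_ge0// integral_ge0.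
Qed.

Let measurable_shift (v : R -> \bar R) : measurable_fun setT v ->
  measurable_fun setT (fun z : R * R => v (z.1 + z.2)%R).
Proof.
move=> mv; apply: (measurableT_comp mv); apply: measurable_funD.
  exact: measurable_fst.
exact: measurable_snd.
Qed.

Lemma measurable_walk_value m : measurable_fun setT (walk_value mu g m).
Proof.
elim: m => [|m IH] /=; first exact: measurable_cst.
apply: emeasurable_funM => //.
apply: (measurable_fun_fubini_tonelli_F (m2 := mu)
  (fun z : R * R => walk_value mu g m (z.1 + z.2)%R)); first exact: measurable_shift.
by move=> z; exact: walk_value_ge0.
Qed.

Context d (T : measurableType d) (P : probability T R).
Variables (H : nat -> set (set T)) (S : nat -> T -> R).
Hypothesis sH : forall j, sigma_algebra setT (H j).
Hypothesis mH : forall j, H j `<=` measurable.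
Hypothesis ndH : forall j, H j `<=` H j.+1.
Hypothesis SH : forall j, preimage_set_system setT (S j) measurable `<=` H j.
Hypothesis law : forall j (B : set R), measurable B ->
  P ((S j.+1 \- S j)%R @^-1` B) = mu B.
Hypothesis indep : forall j, independent_systems P (H j)
  (preimage_set_system setT (S j.+1 \- S j)%R measurable).

(** The weight [Y] makes the induction on [m] possible: it stores the factors already passed, known
    at time j. The induction hypothesis at time j+1 leaves one future step, which is independent of
    [H j]; integrating it out is the recursion of [walk_value]. *)
Lemma walk_expectation_past m j (Y : T -> \bar R) :
  measurable_fun setT (Y : g_sigma_algebraType (H j) -> \bar R) ->
  (forall w, 0 <= Y w) ->
  \int[P]_w (Y w * \prod_(i < m) g (S (j + i)%N w)) =
  \int[P]_w (Y w * walk_value mu g m (S j w)).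
Proof.
elim: m j Y => [|m IH] j Y mY Y0.
  by apply: eq_integral => w _; rewrite big_ord0.
have mSj k : measurable_fun setT (S k : g_sigma_algebraType (H k) -> R).
  by apply: measurable_fun_sub_sigma_algebra; exact: SH.
have mid k := measurable_id_sub_sigma_algebra (@mH k).
have mST k : measurable_fun setT (S k) by exact: (measurableT_comp (mSj k) (mid k)).
have mYg : measurable_fun setT
    ((fun w => Y w * g (S j w)) : g_sigma_algebraType (H j) -> \bar R).
  by apply: emeasurable_funM => //; exact: (measurableT_comp mg (mSj j)).
have Yg0 w : 0 <= Y w * g (S j w) by rewrite mule_ge0.
transitivity (\int[P]_w ((Y w * g (S j w)) * \prod_(i < m) g (S (j.+1 + i)%N w))).
  apply: eq_integral => w _; rewrite big_ord_recl addn0 muleA.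
  by congr (_ * _); apply: eq_bigr => i _; rewrite addSnnS.
rewrite IH//; last first.
  move=> _ B mB; rewrite setTI; apply: sub_gen_smallest; apply: ndH.
  by have := mYg measurableT B mB; rewrite setTI => HB;
    rewrite -(sigma_algebra_id (sH j)); exact: HB.
pose Z := (S j.+1 \- S j)%R.
have mZ : measurable_fun setT Z by exact: measurable_funB.
(* Everything known at time j is a function of the first coordinate; the second is the next step
   alone. *)
pose f (z : g_sigma_algebraType (H j) * R) :=
  (Y z.1 * g (S j z.1)) * walk_value mu g m (S j z.1 + z.2)%R.
transitivity (\int[P]_w f (w, Z w)).
  by apply: eq_integral => w _; rewrite /f/= /Z subrKC.
have mwv := measurable_walk_value m.
rewrite (@ge0_integral_indep _ _ _ _ (g_sigma_algebraType (H j)) _ _ P id Z f)//.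
- apply: eq_integral => w _; rewrite /f/= muleA.
  rewrite ge0_integralZl//; first last.
  + by move=> w' _; exact: walk_value_ge0.
  + apply: (measurableT_comp mwv); exact: measurable_funD.
  congr (_ * _).
  pose ZZ : {RV P >-> R} := mfun_Sub (mem_set mZ).
  transitivity (\int[distribution P ZZ]_z walk_value mu g m (S j w + z)%R).
    rewrite ge0_integral_distribution//.
      by apply: (measurableT_comp mwv); exact: measurable_funD.
    by move=> z; exact: walk_value_ge0.
  by apply: eq_measure_integral => A mA _; exact: law.
- move=> A B mA mB; rewrite preimage_id; apply: (@indep j); last first.
    by exists B => //; rewrite setTI.
  rewrite -(sigma_algebra_id (sH j)); exact: mA.
- apply: emeasurable_funM.
    exact: (measurableT_comp mYg measurable_fst).
  apply: (measurableT_comp mwv); apply: measurable_funD; last exact: measurable_snd.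
  exact: (measurableT_comp (mSj j) measurable_fst).
- by move=> z; rewrite /f mule_ge0// walk_value_ge0.
Qed.

Lemma walk_expectation m : {ae P, forall w, S 0 w = 0%R} ->
  \int[P]_w (\prod_(i < m) g (S i w)) = walk_value mu g m 0%R.
Proof.
move=> S00.
have mST : measurable_fun setT (S 0).
  exact: (measurableT_comp (measurable_fun_sub_sigma_algebra (@SH 0))
    (measurable_id_sub_sigma_algebra (@mH 0))).
transitivity (\int[P]_w walk_value mu g m (S 0 w)).
  rewrite (eq_integral (fun w => 1 * \prod_(i < m) g (S (0 + i)%N w))); last first.
    by move=> w _; rewrite mul1e.
  rewrite (@walk_expectation_past m 0 (cst 1))//.
  by apply: eq_integral => w _; rewrite mul1e.
rewrite (ge0_ae_eq_integral (g := cst (walk_value mu g m 0%R)))//.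
- by rewrite integral_cst//; rewrite -[RHS]mule1; congr (_ * _); exact: probability_setT.
- exact: (measurableT_comp (measurable_walk_value m) mST).
- by move=> w _; exact: walk_value_ge0.
- by move=> w _; exact: walk_value_ge0.
- by apply: filterS S00 => w /= ->.
Qed.
End walk.

(** * Scaling of Lebesgue measure and of centred normal laws *)

Section normal_scale.
Context {R : realType}.
Local Notation mu := (@lebesgue_measure R).

Section lebesgue_scale.
Variables (c : R).
Hypothesis c0 : c != 0.

Let phi : measurableTypeR R -> measurableTypeR R := fun z => c * z.

Let mphi : measurable_fun setT phi.
Proof. exact: measurable_funM. Qed.

Let nu : {measure set (measurableTypeR R) -> \bar R} :=
  measure_function_pushforward__canonical__measure_function_Measure mu mphi.

(** Agreement on half-open intervals suffices by uniqueness of Lebesgue measure. A negative [c],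
    which the reflected walk requires, moves the closed end of the interval to the other side; hence
    the two cases. *)
Lemma lebesgue_measure_scale (A : set R) : measurable A ->
  mu A = mscale (NngNum (normr_ge0 c)) nu A.
Proof.
move=> mA; apply: lebesgue_measure_unique => // _ [[a b] /= _ <-].
rewrite /mscale/= /pushforward/=.
move: (c0); rewrite neq_lt => /orP[cn|cp].
- have -> : phi @^-1` `]a, b] = `[b / c, a / c[%classic.
    apply/seteqP; split => z; rewrite /preimage/= !in_itv/=.
      by rewrite ler_ndivrMr// ltr_ndivlMr// ![z * c]mulrC andbC.
    by rewrite ler_ndivrMr// ltr_ndivlMr// ![z * c]mulrC andbC.
  rewrite !lebesgue_measure_itv/= !lte_fin ltr_nM2r ?invr_lt0//.
  case: ifP => _; last by rewrite mule0.
  rewrite -!EFinB -EFinM ltr0_norm//; congr EFin.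
  by field.
- have -> : phi @^-1` `]a, b] = `]a / c, b / c]%classic.
    apply/seteqP; split => z; rewrite /preimage/= !in_itv/=.
      by rewrite ler_pdivlMr// ltr_pdivrMr// ![z * c]mulrC.
    by rewrite ler_pdivlMr// ltr_pdivrMr// ![z * c]mulrC.
  rewrite !lebesgue_measure_itv/= !lte_fin ltr_pM2r ?invr_gt0//.
  case: ifP => _; last by rewrite mule0.
  rewrite -!EFinB -EFinM gtr0_norm//; congr EFin.
  by field.
Qed.

(** A linear change of variables in the density. By symmetry only [|c|] survives, which is what
    makes reflection harmless. *)
Lemma normal_prob_scale (s : R) (B : set R) : 0 < s -> measurable B ->
  normal_prob 0 s ((fun z => c * z) @^-1` B) = normal_prob 0 (`|c| * s) B.
Proof.
move=> s0 mB; rewrite /normal_prob.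
pose k := NngNum (normr_ge0 c).
have mpdf r : measurable_fun setT (fun z : R => (normal_pdf 0 r z)%:E).
  by apply/measurable_EFinP; exact: measurable_normal_pdf.
have -> : (\int[mu]_(x in B) (normal_pdf 0 (`|c| * s) x)%:E =
    \int[mscale k nu]_(x in B)
      (normal_pdf 0 (`|c| * s) x)%:E)%E.
  by apply: eq_measure_integral => A mA _; exact: lebesgue_measure_scale.
rewrite ge0_integral_mscale//; last 2 first.
- by apply: measurable_funTS; exact: mpdf.
- by move=> x _; rewrite lee_fin normal_pdf_ge0.
have -> : (\int[nu]_(x in B) (normal_pdf 0 (`|c| * s) x)%:E =
    \int[mu]_(x in phi @^-1` B) (normal_pdf 0 (`|c| * s) (phi x))%:E)%E.
  have := @ge0_integral_pushforward _ _ _ _ _ phi mphi mu B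
    (fun x => (normal_pdf 0 (`|c| * s) x)%:E) mB.
  rewrite /nu/=; apply; first by apply: measurable_funTS; exact: mpdf.
  by move=> x _; rewrite lee_fin normal_pdf_ge0.
have mphiB : measurable (phi @^-1` B).
  by rewrite -[X in measurable X]setTI; exact: mphi.
rewrite -ge0_integralZl//; last 2 first.
- by apply: measurable_funTS; exact: (measurableT_comp (mpdf _) mphi).
- by move=> x _; rewrite lee_fin normal_pdf_ge0.
apply: eq_integral => x _ /=.
rewrite -EFinM; congr EFin.
have cs0 : `|c| * s != 0 by rewrite mulf_neq0 ?normr_eq0// gt_eqF.
have sN0 : s != 0 by rewrite gt_eqF.
rewrite (normal_pdfE _ cs0) (normal_pdfE _ sN0) /normal_fun /normal_peak [RHS]mulrA.
have nc0 : `|c| != 0 by rewrite normr_eq0.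
congr (_ * expR _).
  have -> : (`|c| * s) ^+ 2 * pi *+ 2 = `|c| ^+ 2 * (s ^+ 2 * pi *+ 2) by ring.
  by rewrite sqrtrM ?sqr_ge0// sqrtr_sqr normr_id invfM mulrA divff// mul1r.
rewrite !subr0 /phi !exprMn real_normK ?num_real//.
by field; rewrite sN0.
Qed.
End lebesgue_scale.
End normal_scale.

(** * Estimates for products and survival functions *)

(** Exchanging the factors one at a time: each exchange costs at most the change of that factor, the
    others being in [0, 1]. *)
Lemma prod_sub_le (R : realDomainType) (n : nat) (a b : nat -> R) :
  (forall i, 0 <= a i <= 1) -> (forall i, 0 <= b i <= 1) ->
  `|\prod_(i < n) a i - \prod_(i < n) b i| <= \sum_(i < n) `|a i - b i|.
Proof.
move=> a01 b01; elim: n => [|n IH]; first by rewrite !big_ord0 subrr normr0.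
rewrite !big_ord_recr/=.
have pa : `|\prod_(i < n) a i| <= 1.
  rewrite ger0_norm ?prodr_ge0// => [|i _]; last by case/andP: (a01 i).
  by apply: prodr_ile1 => i _.
have -> : (\prod_(i < n) a i) * a n - (\prod_(i < n) b i) * b n =
  (\prod_(i < n) a i - \prod_(i < n) b i) * b n + \prod_(i < n) a i * (a n - b n).
  by ring.
apply: (le_trans (ler_normD _ _)); rewrite !normrM; apply: lerD.
  case/andP: (b01 n) => bn0 bn1; rewrite (ger0_norm bn0).
  by apply: (le_trans _ IH); rewrite ler_piMr.
by rewrite ler_piMl.
Qed.

(** The upper bound comes from exp(-u) <= 1/(1+u) and (1 - u + u^2)(1 + u) = 1 + u^3 >= 1. *)
Lemma expRN_sub_le (R : realType) (u : R) : 0 <= u ->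
  0 <= expR (- u) - (1 - u) <= u ^+ 2.
Proof.
move=> u0; rewrite subr_ge0 expR_ge1Dx/= lerBlDr expRN.
have u1 : 0 < 1 + u by rewrite ltr_wpDr.
apply: (@le_trans _ _ (1 + u)^-1).
  by rewrite lef_pV2 ?posrE ?expR_gt0// expR_ge1Dx.
rewrite -div1r ler_pdivrMr//.
have : 0 <= u ^+ 3 by rewrite exprn_ge0.
by move=> u3; rewrite (_ : _ * _ = 1 + u ^+ 3) ?lerDl//; ring.
Qed.

(** The error bound is proportional to the positive part of y because b such errors get added: an
    absolute bound would be multiplied by b, whereas the sum of these positive parts stays bounded.
    For y <= 0 both functions equal 1. *)
Lemma survival_approx (R : realType) (lambda : R) (G : R -> R) (o : R -> R) :
  0 < lambda -> (forall y, y <= 0 -> G y = 0) ->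
  o y @[y --> 0^'+] --> 0 ->
  (\forall y \near 0^'+, G y = lambda * y * (1 + o y)) ->
  forall e, 0 < e -> exists2 del, 0 < del & forall y, y < del ->
    `|(1 - G y) - expR (- (lambda * Num.max y 0))| <= e * Num.max y 0.
Proof.
move=> l0 G0 oo Go e e0.
have : \forall y \near 0^'+, `|o y| <= e / (2 * lambda).
  by apply: (cvgr0_norm_le _ oo); rewrite divr_gt0// mulr_gt0.
move=> /(filterI Go)[r /= r0 Hr].
(* Each half of [e] pays for one error: [r] makes lambda y |o y| <= (e/2) y, and the second bound
   makes the quadratic error (lambda y)^2 <= (e/2) y. *)
exists (Num.min r (e / (2 * lambda ^+ 2))).
  by rewrite lt_min r0 divr_gt0// mulr_gt0// exprn_gt0.
move=> y; rewrite lt_min => /andP[yr ye].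
have [y0|y0] := leP y 0.
  by rewrite !mulr0 oppr0 expR0 G0// subr0 subrr normr0.
have [|-> oe] := Hr y _ y0; first by rewrite /ball_/= sub0r normrN gtr0_norm.
have ly0 : 0 <= lambda * y by rewrite mulr_ge0// ltW.
have /andP[d0 d1] := expRN_sub_le ly0.
have -> : 1 - lambda * y * (1 + o y) - expR (- (lambda * y)) =
  - (expR (- (lambda * y)) - (1 - lambda * y)) - lambda * y * o y by ring.
apply: (le_trans (ler_normB _ _)).
rewrite normrN (ger0_norm d0) normrM (ger0_norm ly0).
have h1 : (lambda * y) ^+ 2 <= e / 2 * y.
  have -> : (lambda * y) ^+ 2 = (lambda ^+ 2 * y) * y by ring.
  rewrite ler_pM2r//; move: ye; rewrite ltr_pdivlMr ?mulr_gt0 ?exprn_gt0//.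
  move=> /ltW ye; rewrite ler_pdivlMr//.
  by rewrite (_ : _ * _ * _ = y * (2 * lambda ^+ 2)); last by ring.
have h2 : lambda * y * `|o y| <= e / 2 * y.
  have -> : e / 2 * y = lambda * y * (e / (2 * lambda)) by field; rewrite gt_eqF.
  exact: ler_wpM2l.
have -> : e * y = e / 2 * y + e / 2 * y by field.
by apply: lerD => //; exact: le_trans h1.
Qed.

(** * Riemann sums of a continuous function *)

(** The mean value theorem for a primitive, cell by cell, writes the integral as a Riemann sum at
    other sample points; uniform continuity compares the two sums. *)
Lemma riemann_sum_cvg (R : realType) (f : R -> R) : continuous f ->
  b%:R^-1 * \sum_(j < b) f (j%:R / b%:R) @[b --> \oo] -->
  \int[lebesgue_measure]_(t in `[0, 1]) f t.
Proof.
move=> cf.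
have intf a c : lebesgue_measure.-integrable `[a, c] (EFin \o f).
  apply: continuous_compact_integrable; first exact: segment_compact.
  exact: continuous_subspaceT.
have intoc a c : lebesgue_measure.-integrable `]a, c] (EFin \o f).
  by apply: (integrableS _ _ _ (intf a c)) => //; apply: subset_itvr; rewrite bnd_simp.
(* Starting the primitive at -1 makes it differentiable on both sides at 0 as well. *)
pose F (t : R) : R := \int[lebesgue_measure]_(t in `](-1), t]) f t.
have dF (t : R) : -1 < t -> is_derive t 1 F (f t).
  move=> t1.
  have [d1 d2] : derivable F t 1 /\ F^`()%classic t = f t.
    apply: (@continuous_FTC1 _ f (BRight (-1)) t (t + 1)); rewrite ?ltrDl//.
    exact: cf.
  by have := derivableP d1; rewrite -derive1E d2.
have IF : \int[lebesgue_measure]_(t in `[0, 1]) f t = F 1 - F 0.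
  rewrite -Rintegral_itv_obnd_cbnd//.
  by rewrite /F Rintegral_itvB// bnd_simp.
(* Uniform continuity, with 1/b as the modulus because that is the length of a cell; it follows from
   compactness of [0, 1]. *)
have unif e : 0 < e -> \forall b \near \oo, `[0, 1] `<=`
    [set s : R | forall t, `|t - s| <= b%:R^-1 -> `|f t - f s| <= e].
  move=> e0.
  have /compact_near_coveringP cov := @segment_compact R 0 1.
  apply: cov => x _.
  have /cvgrPdist_le /(_ (e / 2)) := cf x.
  rewrite divr_gt0// => /(_ isT) /nbhs_ballP [r /= r0 Hr].
  exists (ball x (r / 2), [set b | b%:R^-1 < r / 2]) => /=.
    split; first by apply: nbhsx_ballx; rewrite divr_gt0.
    have r20 : 0 < r / 2 by rewrite divr_gt0.
    near=> b; rewrite /= -[ltRHS]invrK ltf_pV2 ?posrE ?invr_gt0//; last first.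
      by rewrite ltr0n; near: b; exact: nbhs_infty_gt.
    by near: b; exact: nbhs_infty_gtr.
  move=> [s b] /= [xs br] t ts.
  have h1 : `|f x - f t| <= e / 2.
    apply: Hr; rewrite /ball/= (_ : x - t = (x - s) - (t - s)); last by ring.
    rewrite (splitr r); apply: le_lt_trans (ler_normB _ _) _; apply: ltrD => //.
    exact: le_lt_trans br.
  have h2 : `|f x - f s| <= e / 2.
    apply: Hr; apply: lt_trans xs _; lra.
  rewrite (_ : f t - f s = (f x - f s) - (f x - f t)); last by ring.
  by rewrite (splitr e); apply: le_trans (ler_normB _ _) _; apply: lerD.
apply/cvgrPdist_le => e e0; near=> b.
have b0 : (0 < b)%N by near: b; exact: nbhs_infty_gt.
have bR0 : 0 < b%:R :> R by rewrite ltr0n.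
have bV0 : 0 < b%:R^-1 :> R by rewrite invr_gt0.
have unifb : `[0, 1] `<=` [set s : R | forall t, `|t - s| <= b%:R^-1 -> `|f t - f s| <= e].
  by near: b; exact: unif.
have step j : (j < b)%N ->
    `|F (j.+1%:R / b%:R) - F (j%:R / b%:R) - b%:R^-1 * f (j%:R / b%:R)| <= b%:R^-1 * e.
  move=> jb.
  have jb0 : 0 <= j%:R / b%:R :> R by rewrite divr_ge0.
  have jlt : j%:R / b%:R < j.+1%:R / b%:R :> R by rewrite ltr_pM2r// ltr_nat.
  have [||c cj ->] := @MVT _ F f _ _ jlt.
  - move=> t; rewrite in_itv/= => /andP[jt _]; apply: dF.
    by apply: lt_trans jt; apply: lt_le_trans jb0; rewrite oppr_lt0.
  - apply: derivable_within_continuous => t; rewrite in_itv/= => /andP[jt _].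
    have /dF[] // : -1 < t by apply: lt_le_trans jt; apply: lt_le_trans jb0; rewrite oppr_lt0.
  have -> : j.+1%:R / b%:R - j%:R / b%:R = b%:R^-1 :> R.
    by rewrite -mulrBl -natrB// subSnn mul1r.
  rewrite mulrC -mulrBr normrM gtr0_norm// ler_pM2l//.
  move: cj; rewrite in_itv/= => /andP[c1 c2]; apply: unifb => /=.
    by rewrite in_itv/= jb0/= ler_pdivrMr// mul1r ler_nat ltnW.
  rewrite ger0_norm; last by rewrite subr_ge0 ltW.
  rewrite lerBlDl -[X in _ + X]mul1r -mulrDl natr1.
  exact: ltW.
rewrite IF.
have -> : F 1 - F 0 = \sum_(j < b) (F (j.+1%:R / b%:R) - F (j%:R / b%:R)).
  rewrite -(big_mkord predT (fun j => F (j.+1%:R / b%:R) - F (j%:R / b%:R))).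
  by rewrite (telescope_sumr (fun j => F (j%:R / b%:R)))// mul0r divff ?gt_eqF.
rewrite mulr_sumr -sumrB; apply: le_trans (ler_norm_sum _ _ _) _.
apply: (@le_trans _ _ (\sum_(j < b) b%:R^-1 * e)).
  by apply: ler_sum => j _; apply: step.
by rewrite sumr_const card_ord -mulrnAl -mulr_natl divff ?mul1r// gt_eqF.
Unshelve. all: by end_near. Qed.

(** * Limit of the products along one continuous path *)

Section pointwise_limit.
Context {R : realType}.
Variables (lambda sigma C : R) (G o : R -> R).
Hypotheses (lambda0 : 0 < lambda) (sigma0 : 0 < sigma) (C0 : 0 < C).
Hypothesis G01 : forall y, 0 <= G y <= 1.
Hypothesis G0 : forall y, y <= 0 -> G y = 0.
Hypothesis o0 : o y @[y --> 0^'+] --> 0.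
Hypothesis Go : \forall y \near 0^'+, G y = lambda * y * (1 + o y).
Variables (I : Type) (F : set_system I).
Context {FF : Filter F}.
Variables (b : I -> nat) (s : I -> R).
Hypothesis binf : b @ F --> \oo.
Hypothesis s_ge0 : forall i, 0 <= s i.
Hypothesis s0 : s i @[i --> F] --> 0.
Hypothesis bs : \forall i \near F, lambda * sigma * s i * (b i)%:R = C.

(** The filter is left general because the limit is taken twice: along the admissible n, and along
    all sizes b in order to see that the limit is measurable off a null set. *)
Lemma prod_survival_cvg (x : R) (w : R -> R) :
  {within `[0, +oo[, continuous w} ->
  \prod_(j < b i) (1 - G (sigma * s i * (x + w (j%:R / (b i)%:R)))) @[i --> F] -->
  expR (- (C * \int[lebesgue_measure]_(t in `[0, 1]) Num.max (x + w t) 0)).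
Proof.
move=> cw.
(* The path is frozen at its initial value for negative times, which gives a function continuous on
   the whole line and unchanged on [0, 1]. *)
pose f (t : R) : R := Num.max (x + w (Num.max t 0)) 0.
have cmax : continuous (fun y : R => Num.max y 0).
  by move=> y; apply: (@continuous_max _ _ id (cst 0)); [exact: cvg_id|exact: cst_continuous].
have cf : continuous f.
  move=> t.
  have wt : w (Num.max u 0) @[u --> t] --> w (Num.max t 0).
    have mt0 : `[0, +oo[%classic (Num.max t 0) by rewrite /= in_itv/= andbT le_max lexx orbT.
    have /subspace_continuousP/(_ _ mt0) := cw.
    apply: (@cvg_comp _ _ _ (fun u => Num.max u 0) w) => U /= hU.
    have : \forall u \near t, `[0, +oo[%classic (Num.max u 0) -> U (Num.max u 0).
      exact: (cmax t _ hU).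
    by apply: filterS => u; apply; rewrite /= in_itv/= andbT le_max lexx orbT.
  apply: (@cvg_comp _ _ _ (fun u => x + w (Num.max u 0)) (fun y => Num.max y 0) _
    (nbhs (x + w (Num.max t 0)))); last exact: cmax.
  by apply: cvgD; [exact: cvg_cst|exact: wt].
have fE t : 0 <= t -> f t = Num.max (x + w t) 0 by move=> t0; rewrite /f (max_idPl t0).
have -> : \int[lebesgue_measure]_(t in `[0, 1]) Num.max (x + w t) 0 =
    \int[lebesgue_measure]_(t in `[0, 1]) f t.
  by apply: eq_Rintegral => t; rewrite inE/= in_itv/= => /andP[t0 _]; rewrite fE.
set J := \int[_]_(_ in _) f _.
pose mean i : R := (b i)%:R^-1 * \sum_(j < b i) f (j%:R / (b i)%:R).
have meanJ : mean i @[i --> F] --> J.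
  apply: (@cvg_comp _ _ _ b (fun n => n%:R^-1 * \sum_(j < n) f (j%:R / n%:R) : R) F \oo (nbhs J)) => //.
  exact: riemann_sum_cvg.
have meanlt : \forall i \near F, mean i < J + 1.
  move/cvgrPdist_lt/(_ 1 ltr01) : meanJ; apply: filterS => i.
  by rewrite ltr_norml => /andP[]; lra.
have expJ : expR (- (C * mean i)) @[i --> F] --> expR (- (C * J)).
  apply: (@cvg_comp _ _ _ _ expR _ (nbhs (- (C * J)))); last exact: continuous_expR.
  by apply: cvgN; apply: cvgMr.
(* The maximum f(c) bounds all thresholds of a product at once by sigma s f(c), which tends to 0 and
   so falls below the [del] of [survival_approx]. *)
have [c _ fc] : exists2 c, c \in `[0, 1]%R & forall t, t \in `[0, 1]%R -> f t <= f c.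
  by apply: EVT_max => //; exact: continuous_subspaceT.
have f_ge0 t : 0 <= f t by rewrite /f le_max lexx orbT.
have yE i j : Num.max (sigma * s i * (x + w (j%:R / (b i)%:R))) 0 =
    sigma * s i * f (j%:R / (b i)%:R).
  rewrite fE ?divr_ge0// maxr_pMr ?mulr0// mulr_ge0//; exact: ltW.
have mean_exp : \forall i \near F, expR (- (C * mean i)) =
    \prod_(j < b i) expR (- (lambda * Num.max (sigma * s i * (x + w (j%:R / (b i)%:R))) 0)).
  near=> i.
  have Ci : lambda * sigma * s i * (b i)%:R = C by near: i.
  have bi0 : (b i)%:R != 0 :> R.
    by apply: contraTneq C0 => bi0; rewrite -Ci bi0 mulr0 ltxx.
  rewrite -expR_sum; congr expR.
  rewrite sumrN -mulr_sumr; under [in RHS]eq_bigr do rewrite yE.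
  by rewrite -mulr_sumr /mean -Ci; congr (- _); field.
have diff0 : \prod_(j < b i) (1 - G (sigma * s i * (x + w (j%:R / (b i)%:R))))
    - expR (- (C * mean i)) @[i --> F] --> 0.
  apply/cvgr0Pnorm_le => e e0.
  have J0 : 0 <= J by apply: Rintegral_ge0.
  (* Since sigma s b = C / lambda, the positive parts of the thresholds sum to (C / lambda)
     [mean i], eventually below [D]. The added 1 leaves room above the limit [J] and keeps [D]
     positive when [J] is 0. *)
  pose D := C / lambda * (J + 1).
  have D0 : 0 < D by rewrite mulr_gt0 ?divr_gt0// ltr_wpDl.
  have [del del0 Hdel] := survival_approx lambda0 G0 o0 Go (divr_gt0 e0 D0).
  have sfc : sigma * s i * f c @[i --> F] --> sigma * 0 * f c.
    by apply: cvgMl; apply: cvgMr.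
  near=> i.
  have Ci : lambda * sigma * s i * (b i)%:R = C by near: i.
  have bi0 : (b i)%:R != 0 :> R.
    by apply: contraTneq C0 => bi0; rewrite -Ci bi0 mulr0 ltxx.
  rewrite (near mean_exp i)//.
  apply: le_trans (prod_sub_le (b i)
    (a := fun j => 1 - G (sigma * s i * (x + w (j%:R / (b i)%:R))))
    (b := fun j => expR (- (lambda * Num.max (sigma * s i * (x + w (j%:R / (b i)%:R))) 0))) _ _) _.
  - by move=> j; have /andP[g0 g1] := G01 (sigma * s i * (x + w (j%:R / (b i)%:R))); lra.
  - move=> j; rewrite expR_ge0/= -[leRHS]expR0 ler_expR oppr_le0.
    by rewrite mulr_ge0 ?le_max ?lexx ?orbT//; exact: ltW.
  apply: (@le_trans _ _ (\sum_(j < b i) e / D * (sigma * s i * f (j%:R / (b i)%:R)))).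
    apply: ler_sum => j _; rewrite -yE; apply: Hdel.
    apply: (@le_lt_trans _ _ (sigma * s i * f c)); last first.
      by near: i; apply: (cvgr_lt _ sfc); rewrite mulr0 mul0r.
    apply: (@le_trans _ _ (Num.max (sigma * s i * (x + w (j%:R / (b i)%:R))) 0)).
      by rewrite le_max lexx.
    rewrite yE ler_wpM2l ?mulr_ge0 ?(ltW sigma0)//; apply: fc.
    rewrite in_itv/= divr_ge0//= ler_pdivrMr ?mul1r ?ler_nat ?(ltnW (ltn_ord j))//.
    by rewrite lt0r bi0 ler0n.
  rewrite -mulr_sumr -mulr_sumr.
  have -> : e / D * (sigma * s i * \sum_(j < b i) f (j%:R / (b i)%:R)) =
      e * (mean i / (J + 1)).
    have si0 : s i != 0 by apply: contraTneq C0 => si0; rewrite -Ci si0 mulr0 mul0r ltxx.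
    rewrite /mean /D -Ci; field.
    by rewrite bi0 si0 !gt_eqF// ltr_wpDl.
  rewrite ler_piMr ?(ltW e0)// ler_pdivrMr ?ltr_wpDl// mul1r.
  by apply: ltW; near: i; exact: meanlt.
rewrite -[X in _ --> X]add0r.
apply: cvg_trans (cvgD diff0 expJ); apply: near_eq_cvg.
by near=> i; rewrite /= subrK.
Unshelve. all: by end_near. Qed.
End pointwise_limit.

(** * Bin width and bin size *)

Section bins.
Context {R : realType}.
Variables (K lambda : R).
Hypotheses (K0 : 0 < K) (lambda0 : 0 < lambda).
Local Notation h n := (bin_width K lambda n).
Local Notation b n := (bin_size K lambda n).

Lemma bin_width_gt0 n : (0 < n)%N -> 0 < h n.
Proof.
by move=> n0; rewrite /bin_width mulr_gt0// powR_gt0// mulr_gt0// ltr0n.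
Qed.

(** The calibration behind the exponent 2/3: at the spatial scale sqrt(h), the n h noises of a bin
    have total intensity lambda sqrt(h) n h, and this is kept equal to K. The limits of the bin
    width and of the bin size are both read off this identity. *)
Lemma sqrt_bin_width3 n : (0 < n)%N -> Num.sqrt (h n) ^+ 3 * (n%:R * lambda) = K.
Proof.
move=> n0; have nl0 : 0 < n%:R * lambda by rewrite mulr_gt0// ltr0n.
have h0 := bin_width_gt0 n0.
have -> : Num.sqrt (h n) ^+ 3 = h n `^ (3 / 2).
  by rewrite -powR12_sqrt ?ltW// -powR_mulrn ?powR_ge0// -powRrM; congr (_ `^ _); field.
rewrite /bin_width powRM ?powR_ge0// -!powRrM.
have -> : 2 / 3 * (3 / 2) = 1 :> R by field.
have -> : - (2 / 3) * (3 / 2) = -1 :> R by field.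
by rewrite powRr1 ?ltW// powR_inv1 ?ltW// divfK// gt_eqF.
Qed.

Lemma bin_sizeE n : admissible K lambda n -> (b n)%:R = n%:R * h n.
Proof. by case=> _ _; rewrite /bin_size => /truncnK. Qed.

Lemma sqrt_bin_width_gt0 n : (0 < n)%N -> 0 < Num.sqrt (h n).
Proof. by move=> n0; rewrite sqrtr_gt0 bin_width_gt0. Qed.

Lemma sqrt_bin_width_size n : admissible K lambda n ->
  lambda * Num.sqrt (h n) * (b n)%:R = K.
Proof.
move=> an; have [n0 _ _] := an.
rewrite (bin_sizeE an) -[RHS](sqrt_bin_width3 n0).
rewrite -[X in _ * (_ * X)](sqr_sqrtr (ltW (bin_width_gt0 n0))).
by ring.
Qed.

Lemma sqrt_bin_width_cvg0 :
  Num.sqrt (h n) @[n --> within (admissible K lambda) \oo] --> 0.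
Proof.
apply/cvgr0Pnorm_lt => e e0.
suff : \forall n \near \oo, admissible K lambda n -> `|Num.sqrt (h n)| < e by [].
near=> n => -[n0 _ _].
rewrite ger0_norm ?sqrtr_ge0// ltNge; apply/negP => eh.
have : e ^+ 3 * (n%:R * lambda) <= K.
  rewrite -(sqrt_bin_width3 n0) ler_pM2r ?mulr_gt0 ?ltr0n//.
  by rewrite lerXn2r ?nnegrE ?sqrtr_ge0// ltW.
apply/negP; rewrite -ltNge mulrCA -ltr_pdivrMr ?mulr_gt0 ?exprn_gt0//.
by near: n; exact: nbhs_infty_gtr.
Unshelve. all: by end_near. Qed.

Lemma bin_size_cvgy : b n @[n --> within (admissible K lambda) \oo] --> \oo.
Proof.
move=> A [N _ NA].
have /cvgr0Pnorm_lt/(_ (K / (lambda * N.+1%:R))) := sqrt_bin_width_cvg0.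
rewrite divr_gt0 ?mulr_gt0// => /(_ isT) hs.
suff : \forall n \near \oo, admissible K lambda n -> A (b n) by [].
apply: (@filterS _ \oo _ _ _ _ hs) => n /= hn an; apply: NA => /=.
have [n0 _ _] := an; have s0 := sqrt_bin_width_gt0 n0.
have := hn an; rewrite ger0_norm ?sqrtr_ge0//.
rewrite ltr_pdivlMr ?mulr_gt0// -[ltRHS](sqrt_bin_width_size an).
rewrite mulrCA mulrA ltr_pM2l ?mulr_gt0// ltr_nat => Nb.
by apply: leq_trans Nb; rewrite -addn2 leq_addr.
Qed.

End bins.

(** * The distribution function of the noise *)

Section cdf.
Context d (T : measurableType d) (R : realType) (P : probability T R).
Variables (Y : {RV P >-> R}) (G : R -> R).
Hypothesis cdfE : forall x, cdf Y x = (G x)%:E.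

Lemma cdf_EFin_01 y : 0 <= G y <= 1.
Proof. by rewrite -!lee_fin -cdfE cdf_ge0 cdf_le1. Qed.

Lemma measurable_cdf_EFin : measurable_fun setT G.
Proof.
apply/measurable_EFinP; rewrite (_ : EFin \o G = cdf Y); first exact: cdf_measurable.
by apply/funext => y; rewrite cdfE.
Qed.

(** By monotonicity G(0) lies below every value lambda y (1 + o y) near 0+, and these tend to 0; in
    particular there is no atom at 0. Nonpositive thresholds thus contribute a factor 1, which
    produces the positive part in the limit. *)
Lemma cdf_EFin_le0 (lambda : R) (o : R -> R) :
  o y @[y --> 0^'+] --> 0 ->
  (\forall y \near 0^'+, G y = lambda * y * (1 + o y)) ->
  forall y, y <= 0 -> G y = 0.
Proof.
move=> o0 Go.
have homoG y z : y <= z -> G y <= G z.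
  by move=> yz; rewrite -lee_fin -!cdfE; exact: cdf_nondecreasing.
have G0 : G 0 <= 0.
  have lim0 : lambda * y * (1 + o y) @[y --> 0^'+] --> lambda * 0 * (1 + 0).
    apply: cvgM; last by apply: cvgD => //; exact: cvg_cst.
    by apply: cvgMr; apply: cvg_at_right_filter; exact: cvg_id.
  rewrite mulr0 mul0r in lim0.
  rewrite leNgt; apply/negP => G0.
  have lt0 : \forall y \near 0^'+, lambda * y * (1 + o y) < G 0.
    by apply: (cvgr_lt _ lim0).
  have : \forall y \near 0^'+, [/\ 0 < y, lambda * y * (1 + o y) < G 0 &
      G y = lambda * y * (1 + o y)] by near=> y; split=> //; near: y.
  move=> /filter_ex[y [y0 + Gy]].
  by rewrite -Gy ltNge homoG// ltW.
move=> y y0; apply/eqP; rewrite eq_le; apply/andP; split.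
  by apply: le_trans G0; exact: homoG.
by have /andP[] := cdf_EFin_01 y.
Unshelve. all: by end_near. Qed.
End cdf.

(** * Brownian motion sampled on a grid *)

Section normal_law.
Context {R : realType}.

Let id_borel : measurableTypeR R -> R := idfun.

Let measurable_id_borel : measurable_fun setT id_borel.
Proof. by move=> _ B mB; rewrite setTI. Qed.

(* normal_prob lives on measurableTypeR R, which has the same measurable sets
   as R but another display. *)
Definition normal_law (s : R) : probability R R :=
  distribution (normal_prob 0 s) (mfun_Sub (mem_set measurable_id_borel)).

Lemma normal_lawE s (B : set R) : normal_law s B = normal_prob 0 s B.
Proof. by []. Qed.

End normal_law.

(** Time shift, Brownian scaling and reflection at once: the value involves [tau] and [c] only
    through |c| sqrt(tau), and [a] not at all, so two sampled walks may be exchanged as soon as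
    these numbers agree. *)
Lemma brownian_walk_expectation d (T : measurableType d) (R : realType)
    (P : probability T R) (F : R -> set (set T)) (W : R -> T -> R)
    (a tau c : R) (g : R -> \bar R) (m : nat) :
  filtration F -> standard_brownian_motion P F W ->
  0 <= a -> 0 < tau -> c != 0 ->
  measurable_fun setT g -> (forall y, (0 <= g y)%E) ->
  (\int[P]_w \prod_(i < m) g (c * (W (a + i%:R * tau)%R w - W a w))%R)%E =
  walk_value (normal_law (`|c| * Num.sqrt tau)) g m 0.
Proof.
move=> [sF mF ndF] [adW _ _ lawW indepW] a0 tau0 c0 mg g0.
have t0 j : 0 <= a + j%:R * tau by rewrite addr_ge0// mulr_ge0// ltW.
have mW s t : 0 <= s -> s <= t ->
    measurable_fun setT (W s : g_sigma_algebraType (F t) -> R).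
  move=> s0 st; apply: measurable_fun_sub_sigma_algebra => B /adW FB.
  by apply: (ndF s) => //; apply: FB; rewrite /= in_itv/= s0.
pose S (j : nat) w := c * (W (a + j%:R * tau) w - W a w).
have tS j : a + j.+1%:R * tau - (a + j%:R * tau) = tau.
  by rewrite -natr1; ring.
have tlt j : a + j%:R * tau < a + j.+1%:R * tau.
  by rewrite -subr_gt0 tS.
have SE j : S j.+1 \- S j =
    (fun z => c * z) \o (W (a + j.+1%:R * tau) \- W (a + j%:R * tau)).
  by apply/funext => w; rewrite /S/=; ring.
have mscale (B : set R) : measurable B -> measurable ((fun z : R => c * z) @^-1` B).
  move=> mB; rewrite -[X in measurable X]setTI.
  have : measurable_fun setT (fun z : R => c * z) by exact: measurable_funM.
  by apply.
apply: (@walk_expectation R (normal_law (`|c| * Num.sqrt tau)) g mg g0 d T P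
  (fun j => F (a + j%:R * tau)) S) => //.
- by move=> j; exact: sF.
- by move=> j; exact: mF.
- by move=> j; apply: ndF => //; exact: ltW.
- move=> j _ [B mB <-]; rewrite setTI -(sigma_algebra_id (sF _ (t0 j))).
  have : measurable_fun setT (S j : g_sigma_algebraType (F (a + j%:R * tau)) -> R).
    apply: measurable_funM; first exact: measurable_cst.
    apply: measurable_funB; first exact: mW.
    by apply: mW => //; rewrite lerDl mulr_ge0// ltW.
  by move=> /(_ measurableT B mB); rewrite setTI.
- move=> j B mB; rewrite SE comp_preimage lawW//; last exact: mscale.
  by rewrite tS normal_lawE normal_prob_scale// sqrtr_gt0.
- move=> j A _ FA [B mB <-]; rewrite setTI SE comp_preimage.
  by apply: (indepW _ _ (t0 j) (tlt j)) => //; exists ((fun z => c * z) @^-1` B);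
    [exact: mscale|rewrite setTI].
- by apply: aeW => w; rewrite /S mul0r addr0 subrr mulr0.
Qed.

(** * Exceedance probability of one bin *)

Lemma lt_bigmin_seq (R : realDomainType) (I : Type) (s : seq I) (f : I -> R) (x x0 : R) :
  (x < \big[Order.min/x0]_(i <- s) f i) = (x < x0) && all (fun i => x < f i) s.
Proof.
elim: s => [|i s IH]; first by rewrite big_nil andbT.
by rewrite big_cons lt_min IH /= andbCA.
Qed.

Lemma bin_residual_gt (R : realType) (T : Type) (K lambda : R) (X : R -> T -> R)
    (eps : nat -> T -> R) (n k : nat) (y : R) (w : T) :
  (0 < bin_size K lambda n)%N ->
  (y < bin_residual K lambda X eps n k w) <->
  (forall j, (j < bin_size K lambda n)%N ->
    y - (X ((k * bin_size K lambda n + j)%:R / n%:R) w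
         - X (k%:R * bin_width K lambda n) w)
      < eps (k * bin_size K lambda n + j)%N w).
Proof.
set b := bin_size K lambda n => b0.
rewrite /bin_residual ltrBrDr /bin_min -/b lt_bigmin_seq /observation.
split.
  case/andP=> _ /allP ymin j jb.
  have := ymin (k * b + j)%N; rewrite mem_index_iota leq_addr mulSn addnC ltn_add2r.
  by move=> /(_ jb); rewrite addnC; lra.
move=> yeps; apply/andP; split.
  (* The default value of the minimum is the observation with j = 0, which exists because the bin is
     nonempty. *)
  by have := yeps _ b0; rewrite addn0; lra.
apply/allP => i; rewrite mem_index_iota => /andP[ki ik].
have ib : (i - k * b < b)%N by rewrite ltn_subLR// -mulSnr.
by have := yeps _ ib; rewrite subnKC//; lra.
Qed.

(** The description of X by W has an exceptional null set for each time; only the grid times of the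
    bin enter, so these null sets can be merged. *)
Lemma integral_prod_ae_eq d (T : measurableType d) (R : realType)
    (P : probability T R) (f : R -> R) (b : nat) (u v : nat -> T -> R) :
  measurable_fun setT f -> (forall y, 0 <= f y) ->
  (forall j, (j < b)%N -> measurable_fun setT (u j)) ->
  (forall j, (j < b)%N -> measurable_fun setT (v j)) ->
  (forall j, (j < b)%N -> {ae P, forall w, u j w = v j w}) ->
  (\int[P]_w (\prod_(j < b) f (u j w))%:E =
   \int[P]_w (\prod_(j < b) f (v j w))%:E)%E.
Proof.
move=> mf f0 mu mv uv; apply: ge0_ae_eq_integral => //.
- apply/measurable_EFinP/measurable_prod => j _.
  by apply: (measurableT_comp mf); exact: mu.
- apply/measurable_EFinP/measurable_prod => j _.
  by apply: (measurableT_comp mf); exact: mv.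
- by move=> w _; rewrite lee_fin prodr_ge0.
- by move=> w _; rewrite lee_fin prodr_ge0.
have : {ae P, forall w, forall j, (j < b)%N -> u j w = v j w}.
  apply: ae_foralln => j; have [jb|bj] := boolP (j < b)%N; last exact: aeW.
  by apply: filterS (uv j jb) => w ->.
by apply: filterS => w uvw _; congr EFin; apply: eq_bigr => j _; rewrite uvw.
Qed.

Lemma bin_exceedance_prob d (T : measurableType d) (R : realType)
    (P : probability T R) (lambda K sigma : R)
    (F : R -> set (set T)) (W : R -> T -> R) (X : R -> T -> R)
    (eps : nat -> {RV P >-> R}) (G : R -> R) (k n : nat) (x : R) :
  0 < lambda -> 0 < K -> 0 < sigma ->
  filtration F -> standard_brownian_motion P F W -> adapted `[0, 1] F X ->
  mutually_independent P (fun i => eps i : T -> R) ->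
  (forall i x, cdf (eps i) x = (G x)%:E) ->
  independent_systems P
    (sigma_gen setT (fun i => eps i : T -> R)) (sigma_gen `[0, 1] X) ->
  admissible K lambda n ->
  k.+1%:R * bin_width K lambda n <= 1 ->
  (forall t, k%:R * bin_width K lambda n <= t < k.+1%:R * bin_width K lambda n ->
      {ae P, forall w,
        X t w = X (k%:R * bin_width K lambda n) w
                + stoch_int_cst sigma W (k%:R * bin_width K lambda n) t w}) ->
  P [set w | bin_width K lambda n `^ (- (1 / 2)) *
             bin_residual K lambda X (fun i => eps i : T -> R) n k w
             > x * sigma] =
  (\int[P]_w (\prod_(j < bin_size K lambda n)
    (1 - G (sigma * Num.sqrt (bin_width K lambda n) *
       (x + W (j%:R / (bin_size K lambda n)%:R) w))))%:E)%E.
Proof.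
move=> lambda0 K0 sigma0 Ffil WBM Xad indep cdfE epsX an kh1 Xbin.
have [n0 _ _] := an.
set h := bin_width K lambda n in kh1 Xbin *.
have bE : (bin_size K lambda n)%:R = n%:R * h := bin_sizeE an.
set b := bin_size K lambda n in bE *.
have h0 : 0 < h := bin_width_gt0 K0 lambda0 n0.
have nR0 : 0 < n%:R :> R by rewrite ltr0n.
have b0 : (0 < b)%N by rewrite -(ltr0n R) bE mulr_gt0.
have bR0 : 0 < b%:R :> R by rewrite ltr0n.
set s := Num.sqrt h.
have s0 : 0 < s by rewrite sqrtr_gt0.
have s2 : s ^+ 2 = h by rewrite sqr_sqrtr// ltW.
have tE j : (k * b + j)%:R / n%:R = k%:R * h + j%:R * n%:R^-1 :> R.
  by rewrite natrD natrM bE; field; rewrite gt_eqF.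
have jn j : (j < b)%N -> j%:R * n%:R^-1 < h.
  by move=> jb; rewrite ltr_pdivrMr// mulrC -bE ltr_nat.
have tin j : (j < b)%N -> k%:R * h <= (k * b + j)%:R / n%:R < k.+1%:R * h.
  by move=> jb; rewrite tE lerDl divr_ge0//= -natr1 mulrDl mul1r ltrD2l jn.
have tin1 j : (j < b)%N -> `[0, 1]%classic ((k * b + j)%:R / n%:R : R).
  move=> jb; have /andP[_ t2] := tin j jb.
  by rewrite /= in_itv/= divr_ge0//= (le_trans (ltW t2)).
pose U j w := x * sigma * s - (X ((k * b + j)%:R / n%:R) w - X (k%:R * h) w).
have -> : [set w | h `^ (- (1 / 2)) *
      bin_residual K lambda X (fun i => eps i : T -> R) n k w > x * sigma] =
    [set w | forall j, (j < b)%N -> U j w < eps (k * b + j)%N w].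
  apply/funext => w /=; apply/propext.
  rewrite powRN div1r powR12_sqrt ?ltW// -/s [X in _ < X]mulrC ltr_pdivlMr//.
  exact: bin_residual_gt.
have Xm t : `[0, 1]%classic t -> preimage_set_system setT (X t) measurable `<=`
    \bigcup_(i in `[0, 1]) preimage_set_system setT (X i) measurable.
  by move=> t01 A XA; exists t.
have FX : sigma_gen `[0, 1] X `<=` measurable.
  apply: smallest_sub; first exact: sigma_algebra_measurable.
  move=> A [t t01 XA]; have [_ mF _] := Ffil; apply: (mF t).
    by move: t01; rewrite /= in_itv/= => /andP[].
  exact: Xad XA.
have sX : sigma_algebra setT (sigma_gen `[0, 1] X) by exact: smallest_sigma_algebra.
have kh01 : `[0, 1]%classic (k%:R * h).
  by have := tin1 0 b0; rewrite tE mul0r addr0.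
rewrite (prob_gt_indep (U := U) _ indep cdfE sX FX epsX); last first.
  move=> j jb _ [B mB <-]; rewrite setTI.
  have : measurable_fun setT (U j : g_sigma_algebraType
      (\bigcup_(i in `[0, 1]) preimage_set_system setT (X i) measurable) -> R).
    apply: measurable_funB; first exact: measurable_cst.
    apply: measurable_funB; apply: measurable_fun_sub_sigma_algebra; apply: Xm => //.
    exact: tin1.
  by move=> /(_ measurableT B mB); rewrite setTI.
pose g y := (1 - G (sigma * s * (x + y)))%:E.
have mg : measurable_fun setT g.
  apply/measurable_EFinP; apply: measurable_funB; first exact: measurable_cst.
  apply: (measurableT_comp (measurable_cdf_EFin (cdfE 0))).
  by apply: measurable_funM => //; apply: measurable_funD.
have g_ge0 y : (0 <= g y)%E.
  by have /andP[_] := cdf_EFin_01 (cdfE 0) (sigma * s * (x + y)); rewrite lee_fin subr_ge0.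
have [_ mF _] := Ffil; have [Wad W00 _ _ _] := WBM.
have mW t : 0 <= t -> measurable_fun setT (W t).
  move=> t0 _ B mB; rewrite setTI; apply: (mF t t0); apply: (Wad t).
    by rewrite /= in_itv/= t0.
  by exists B => //; rewrite setTI.
have mX t : `[0, 1]%classic t -> measurable_fun setT (X t).
  move=> t01 _ B mB; rewrite setTI; apply: FX; apply: sub_sigma_algebra.
  by exists t => //; exists B => //; rewrite setTI.
have kh_ge0 : 0 <= k%:R * h by rewrite mulr_ge0// ltW.
have mf : measurable_fun setT (fun y => 1 - G y).
  by apply: measurable_funB => //; exact: measurable_cdf_EFin (cdfE 0).
have f0 y : 0 <= 1 - G y.
  by have /andP[_] := cdf_EFin_01 (cdfE 0) y; rewrite subr_ge0.
(* The threshold x sigma s - sigma (W_t - W_kh) with sigma s factored out: the walk appears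
   multiplied by c = -1/s, a reflection and a rescaling. *)
pose V j w := sigma * s * (x + - s^-1 * (W (k%:R * h + j%:R * n%:R^-1) w - W (k%:R * h) w)).
rewrite (@integral_prod_ae_eq _ _ _ _ (fun y => 1 - G y) b U V)//; first last.
- move=> j jb; apply: filterS (Xbin _ (tin j jb)) => w.
  rewrite /U /V /stoch_int_cst tE => ->.
  by field; rewrite gt_eqF.
- move=> j jb; apply: measurable_funM => //; apply: measurable_funD => //.
  apply: measurable_funM => //; apply: measurable_funB; apply: mW => //.
  by rewrite addr_ge0// divr_ge0.
- move=> j jb; apply: measurable_funB => //; apply: measurable_funB; apply: mX => //.
  exact: tin1.
(* The steps of the bin walk have standard deviation s^-1 n^(-1/2) = (n h)^(-1/2) = b^(-1/2), as do
   the increments of W on the grid j/b started at time 0 with c = 1. *)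
transitivity (walk_value (normal_law (Num.sqrt b%:R^-1)) g b 0).
  have sb : `|- s^-1| * Num.sqrt n%:R^-1 = Num.sqrt b%:R^-1.
    rewrite normrN ger0_norm ?invr_ge0 ?sqrtr_ge0// bE invfM sqrtrM ?invr_ge0//.
    by rewrite mulrC (sqrtrV (ltW h0)).
  rewrite -sb -(brownian_walk_expectation b Ffil WBM kh_ge0 _ _ mg g_ge0)//.
  - by apply: eq_integral => w _; rewrite -prodEFin.
  - by rewrite invr_gt0.
  - by rewrite oppr_eq0 invr_eq0 gt_eqF.
have sb : `|1| * Num.sqrt b%:R^-1 = Num.sqrt b%:R^-1 :> R by rewrite normr1 mul1r.
rewrite -sb -(brownian_walk_expectation b Ffil WBM (lexx 0) _ _ mg g_ge0)//; last 1 first.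
  by rewrite invr_gt0.
transitivity (\int[P]_w (\prod_(j < b) (1 - G (sigma * s *
    (x + 1 * (W (0 + j%:R * b%:R^-1) w - W 0 w)))))%:E)%E.
  by apply: eq_integral => w _; rewrite -prodEFin.
apply: (@integral_prod_ae_eq _ _ _ _ (fun y => 1 - G y) b
  (fun j w => sigma * s * (x + 1 * (W (0 + j%:R * b%:R^-1) w - W 0 w)))
  (fun j w => sigma * s * (x + W (j%:R / b%:R) w))) => //.
- move=> j jb; apply: measurable_funM => //; apply: measurable_funD => //.
  apply: measurable_funM => //; apply: measurable_funB; apply: mW => //.
- move=> j jb; apply: measurable_funM => //; apply: measurable_funD => //.
  by apply: mW; rewrite divr_ge0.
- by move=> j jb; apply: filterS W00 => w ->; rewrite add0r subr0 mul1r.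
Qed.

(* The integral of a non-measurable nonnegative function is a lower integral,
   which is still insensitive to null sets. *)
Lemma integral_setC_null d (T : measurableType d) (R : realType)
    (P : {measure set T -> \bar R}) (N : set T) (f : T -> \bar R) :
  measurable N -> P N = 0%E -> (forall w, 0 <= f w)%E ->
  measurable_fun (~` N) f ->
  (\int[P]_w f w = \int[P]_(w in ~` N) f w)%E.
Proof.
move=> mN N0 f0 mf.
have le_int (u v : T -> \bar R) : (forall w, 0 <= u w)%E -> (forall w, u w <= v w)%E ->
    (\int[P]_w u w <= \int[P]_w v w)%E.
  move=> u0 uv; have v0 w : (0 <= v w)%E by apply: le_trans (uv w).
  rewrite !ge0_integralTE//; apply: le_ereal_sup => _ [h hu <-].
  by exists h => //= w; apply: le_trans (uv w); exact: hu.
rewrite [RHS]integral_mkcond; set g := f \_ (~` N).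
have g0 w : (0 <= g w)%E by rewrite /g patchE; case: ifP.
have mg : measurable_fun setT g.
  by apply/(measurable_restrictT _ _).1 => //; exact: measurableC.
apply/eqP; rewrite eq_le; apply/andP; split; last first.
  by apply: le_int => // w; rewrite /g patchE; case: ifP.
(* Adding +oo on [N] gives a measurable majorant of f at no cost, since +oo times the null measure
   of [N] is 0. *)
have mI : measurable_fun setT (fun w => (+oo * (\1_N w)%:E)%E : \bar R).
  by apply: emeasurable_funM => //; apply/measurable_EFinP; exact: measurable_indic.
apply: (@le_trans _ _ (\int[P]_w (g w + +oo * (\1_N w)%:E))%E).
  apply: le_int => // w; rewrite /g patchE indicE in_setC.
  have [wN|wN] /= := boolP (w \in N).
    by rewrite mule1 add0e leey.
  by rewrite mule0 adde0.
rewrite ge0_integralD//.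
have -> : (\int[P]_w (+oo * (\1_N w)%:E) = 0)%E; last by rewrite adde0.
rewrite ge0_integralZl//; last by apply/measurable_EFinP; exact: measurable_indic.
by rewrite integral_indic// setIT N0 mule0.
Qed.

(** * Passage to the limit *)

Theorem proposition3p2
  (d : measure_display) (T : measurableType d) (R : realType)
  (P : probability T R)
  (lambda K sigma : R)
  (lambda_gt0 : 0 < lambda) (K_gt0 : 0 < K) (sigma_gt0 : 0 < sigma)
  (F : R -> set (set T)) (F_filtration : filtration F)
  (W : R -> T -> R) (W_bm : standard_brownian_motion P F W)
  (X : R -> T -> R) (X_adapted : adapted `[0, 1] F X)
  (eps : nat -> {RV P >-> R})
  (eps_ge0 : forall i, {ae P, forall w, 0 <= eps i w})
  (eps_indep : mutually_independent P (fun i => eps i : T -> R))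
  (Flambda : R -> R)
  (eps_cdf : forall i x, cdf (eps i) x = (Flambda x)%:E)
  (Flambda_at0 : exists o : R -> R, o y @[y --> 0^'+] --> 0 /\
    \forall y \near 0^'+, Flambda y = lambda * y * (1 + o y))
  (eps_X_indep : independent_systems P
    (sigma_gen setT (fun i => eps i : T -> R)) (sigma_gen `[0, 1] X))
  (k : nat)
  (X_bin : forall n, admissible K lambda n ->
    let h := bin_width K lambda n in
    k.+1%:R * h <= 1 ->
    forall t, k%:R * h <= t < k.+1%:R * h ->
      {ae P, forall w,
        X t w = X (k%:R * h) w + stoch_int_cst sigma W (k%:R * h) t w})
  (x : R) :
  P [set w | bin_width K lambda n `^ (- (1 / 2)) *
             bin_residual K lambda X (fun i => eps i : T -> R) n k w
             > x * sigma]
    @[n --> within (admissible K lambda) \oo] -->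
  ('E_P[fun w => expR (- K * sigma *
     \int[lebesgue_measure]_(t in `[0%R, 1%R]) Num.max (x + W t w) 0)%R])%E.
Proof.
have [_ _ Wcont _ _] := W_bm; have [_ mF _] := F_filtration.
have [r [r0 Flambda_r]] := Flambda_at0.
have G01 := cdf_EFin_01 (eps_cdf 0).
have G0 := cdf_EFin_le0 (eps_cdf 0) r0 Flambda_r.
have C0 : 0 < K * sigma by rewrite mulr_gt0.
have [N [mN N0 subN]] := Wcont.
have Wc w : (~` N) w -> {within `[0, +oo[, continuous (fun t => W t w)}.
  by move=> Nw; apply: contrapT => ncont; apply: Nw; exact: subN.
have mW t : 0 <= t -> measurable_fun setT (W t).
  move=> t0 _ B mB; rewrite setTI; apply: (mF t t0).
  have [Wad _ _ _ _] := W_bm; apply: (Wad t); first by rewrite /= in_itv/= t0.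
  by exists B => //; rewrite setTI.
pose f (s : R) (b : nat) (w : T) : R :=
  \prod_(j < b) (1 - Flambda (sigma * s * (x + W (j%:R / b%:R) w))).
have mf s b : measurable_fun setT (f s b).
  apply: measurable_prod => j _; apply: measurable_funB => //.
  apply: (measurableT_comp (measurable_cdf_EFin (eps_cdf 0))).
  apply: measurable_funM => //; apply: measurable_funD => //.
  by apply: mW; rewrite divr_ge0.
have f01 s b w : 0 <= f s b w <= 1.
  have G01' j : 0 <= 1 - Flambda (sigma * s * (x + W (j%:R / b%:R) w)) <= 1.
    by have /andP[] := G01 (sigma * s * (x + W (j%:R / b%:R) w)); lra.
  rewrite prodr_ge0 => [|j _]; last by have /andP[] := G01' j.
  by apply: prodr_ile1 => j _; exact: G01'.
pose L w := expR (- (K * sigma *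
  \int[lebesgue_measure]_(t in `[0, 1]) Num.max (x + W t w) 0)).
have L01 w : 0 <= L w <= 1.
  rewrite expR_ge0/= -[leRHS]expR0 ler_expR oppr_le0 mulr_ge0 ?(ltW C0)//.
  by apply: Rintegral_ge0 => t _; rewrite le_max lexx orbT.
have mND : measurable (~` N) by exact: measurableC.
(* Off N, L is a limit of the same products along all b, not only along the
   possibly finitely many admissible n. *)
have mL : measurable_fun (~` N) L.
  (* Chosen so that lambda sigma s_i i = K sigma for i > 0, the relation satisfied by sqrt(h) and
     the bin size at admissible n. *)
  pose s i : R := K / (lambda * i%:R).
  apply: (@measurable_fun_cvg _ _ _ _ (fun i => f (s i) i)) => [i|w /Wc cw].
    by apply: measurable_funTS; exact: mf.
  apply: (prod_survival_cvg (b := id) (s := s) lambda_gt0 sigma_gt0 C0 G01 G0 r0 Flambda_r) => //.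
  - by move=> i; rewrite divr_ge0 ?mulr_ge0// ltW.
  - apply/cvgr0Pnorm_lt => e e0; near=> i.
    have i0 : 0 < i%:R :> R by rewrite ltr0n; near: i; exact: nbhs_infty_gt.
    rewrite ger0_norm ?divr_ge0 ?mulr_ge0 ?ltW//.
    rewrite /s invfM mulrA ltr_pdivrMr// [X in _ < X]mulrC -ltr_pdivrMr//.
    by near: i; exact: nbhs_infty_gtr.
  - near=> i.
    have i0 : i%:R != 0 :> R by rewrite pnatr_eq0 -lt0n; near: i; exact: nbhs_infty_gt.
    by rewrite /s; field; rewrite i0 gt_eqF.
have E_L : 'E_P[fun w => expR (- K * sigma *
    \int[lebesgue_measure]_(t in `[0%R, 1%R]) Num.max (x + W t w) 0)%R]%E =
    (\int[P]_(w in ~` N) (L w)%:E)%E.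
  rewrite unlock -(integral_setC_null mN N0)//.
  - by apply: eq_integral => w _; rewrite /L !mulNr.
  - by move=> w; rewrite lee_fin; case/andP: (L01 w).
  - exact/measurable_EFinP.
rewrite E_L.
pose s n := Num.sqrt (bin_width K lambda n).
(* Dominated convergence is a statement about the filter \oo, hence the value L
   at non-admissible n. *)
pose fA n w := if pselect (admissible K lambda n)
  then f (s n) (bin_size K lambda n) w else L w.
have dct : (\int[P]_(w in ~` N) (fA n w)%:E)%E @[n --> \oo] -->
    (\int[P]_(w in ~` N) (L w)%:E)%E.
  apply: (@dominated_cvg _ _ _ P _ mND (fun n w => (fA n w)%:E) _ (cst 1%E)) => //.
  - move=> n; apply/measurable_EFinP; rewrite /fA; case: pselect => an //.
    by apply: measurable_funTS; exact: mf.
  - move=> w /Wc cw; apply: cvg_EFin; first exact: nearW.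
    have : f (s n) (bin_size K lambda n) w @[n --> within (admissible K lambda) \oo] --> L w.
      apply: (prod_survival_cvg lambda_gt0 sigma_gt0 C0 G01 G0 r0 Flambda_r
        (bin_size_cvgy K_gt0 lambda_gt0) _ (sqrt_bin_width_cvg0 K_gt0 lambda_gt0)) => //.
      suff : \forall n \near \oo, admissible K lambda n ->
        lambda * sigma * s n * (bin_size K lambda n)%:R = K * sigma by [].
      by near=> n => an; rewrite -[in RHS](sqrt_bin_width_size K_gt0 lambda_gt0 an) /s; ring.
    move=> cvgf U LU; have /= := cvgf U LU; rewrite /within/=.
    have : \forall n \near \oo, True by near=> n.
    apply: filterS2 => n _ /=; rewrite /fA; case: pselect => an; first by apply.
    (* At a non-admissible n the value is the limit itself, which lies in each of its
       neighbourhoods. *)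
    by move=> _; exact: nbhs_singleton.
  - exact: finite_measure_integrable_cst.
  - move=> n w _; have /andP[fA0 fA1] : 0 <= fA n w <= 1.
      by rewrite /fA; case: pselect => an /=; [exact: f01|exact: L01].
    by rewrite /= lee_fin ger0_norm.
move=> U /dct Udct.
suff : \forall n \near \oo, admissible K lambda n ->
  U (P [set w | bin_width K lambda n `^ (- (1 / 2)) *
    bin_residual K lambda X (fun i => eps i : T -> R) n k w > x * sigma]) by [].
(* The bin must lie inside [0, 1] for [X_bin] to apply. With s = sqrt(h) below both 1 and 1/(k+1),
   one gets h = s^2 <= s < 1/(k+1). *)
have hk : \forall n \near \oo, admissible K lambda n ->
    k.+1%:R * bin_width K lambda n <= 1.
  have k0 : 0 < k.+1%:R^-1 :> R by rewrite invr_gt0.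
  have /cvgr0_norm_lt s_lt := sqrt_bin_width_cvg0 K_gt0 lambda_gt0.
  have slt e : 0 < e -> \forall n \near \oo, admissible K lambda n -> `|s n| < e.
    by move=> e0; exact: s_lt.
  apply: filterS2 (slt _ ltr01) (slt _ k0) => n s1 sk an.
  have [n0 _ _] := an; have s_gt0 := sqrt_bin_width_gt0 K_gt0 lambda_gt0 n0.
  move: (s1 an) (sk an); rewrite gtr0_norm// => {}s1 {}sk.
  rewrite -(sqr_sqrtr (ltW (bin_width_gt0 K_gt0 lambda_gt0 n0))) -/(s n).
  rewrite mulrC -ler_pdivlMr// mul1r expr2.
  by apply: le_trans (ltW sk); rewrite ger_pMr// ltW.
near=> n => an.
have hkn : k.+1%:R * bin_width K lambda n <= 1 by apply: (near hk n).
rewrite (bin_exceedance_prob x lambda_gt0 K_gt0 sigma_gt0 F_filtration W_bm X_adapted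
  eps_indep eps_cdf eps_X_indep an hkn (X_bin n an hkn)).
have -> : (\int[P]_w (\prod_(j < bin_size K lambda n) (1 - Flambda (sigma *
    Num.sqrt (bin_width K lambda n) * (x + W (j%:R / (bin_size K lambda n)%:R) w))))%:E =
    \int[P]_(w in ~` N) (fA n w)%:E)%E.
  rewrite (integral_setC_null mN N0).
  - by apply: eq_integral => w _; rewrite /fA; case: pselect.
  - by move=> w; rewrite lee_fin; case/andP: (f01 (s n) (bin_size K lambda n) w).
  - by apply: measurable_funTS; apply/measurable_EFinP; exact: mf.
by near: n.
Unshelve. all: by end_near. Qed.
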